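(* Let $F$ be a field and let $*_\mu$ be a multiplication on the space $\mathfrak C$ of $m\times m\times m$ cubic matrices over $F$ such that the algebra $\mathfrak C_\mu=(\mathfrak C,*_\mu)$ is associative and commutative. Let $\{\mathcal M^{[s,t]}\},\{\mathcal N^{[s,t]}\}\subset\mathfrak C_\mu$ be two families of cubic matrices which generate two flows of algebras (FAs) of type $\mu$. Then the family of matrices $$\mathcal B^{[s,t]}=\mathcal M^{[s,t]}*_\mu\mathcal N^{[s,t]}$$ generates an FA of type $\mu$.
   Context: A cubic matrix over $F$ is an array $Q=(q_{ijk})_{i,j,k=1}^m$ with entries in $F$; $\mathfrak C$ is the $m^3$-dimensional $F$-vector space of all of them (entrywise operations). A multiplication $*_\mu$ on $\mathfrak C$ is an arbitrary $F$-bilinear map $\mathfrak C\times\mathfrak C\to\mathfrak C$, and $\mathfrak C_\mu=(\mathfrak C,*_\mu)$ is the resulting algebra. A family of cubic matrices $\mathcal M^{[s,t]}=(c^{[s,t]}_{ijk})_{i,j,k=1}^m$, $0\le s\le t$ real, generates an FA (flow of algebras) of type $\mu$ if it satisfies the Kolmogorov-Chapman equation $\mathcal M^{[s,t]}=\mathcal M^{[s,\tau]}*_\mu\mathcal M^{[\tau,t]}$ for all $0\le s<\tau<t$; the FA is then the family of $m$-dimensional algebras $\mathcal A^{[s,t]}$ over $F$ with basis $e_1,\dots,e_m$ and products $e_ie_j=\sum_{k=1}^m c^{[s,t]}_{ijk}e_k$. *)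

(* Defs.v *)
From mathcomp Require Export all_boot all_order all_algebra.
From mathcomp Require Export sesquilinear reals.

Set Implicit Arguments.
Unset Strict Implicit.
Unset Printing Implicit Defensive.

Import Order.TTheory GRing.Theory Num.Theory.

Local Open Scope ring_scope.

(* [q (i, j, k)] is the entry q_ijk.  The codomain is [F^o], i.e. F viewed as a
   module over itself, so that the entrywise F-vector space structure on cubic
   matrices is the library's one on finite functions. *)
Definition cubic (F : fieldType) (m : nat) : Type :=
  {ffun 'I_m * 'I_m * 'I_m -> F^o}.

Definition cubic_mul (F : fieldType) (m : nat) : Type :=
  {bilinear cubic F m -> cubic F m -> cubic F m}.

Identity Coercion bilinear_of_cubic_mul : cubic_mul >-> bilinear.

(* A family M^[s,t], 0 <= s <= t, is represented by a total function of (s, t)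
   whose values outside that domain are never constrained.  The flow consists of
   the algebras on F^m whose structure constants are the entries of M^[s,t], so
   that [M] generates one exactly when the Kolmogorov-Chapman equation holds. *)
Definition generates_FA (R : realType) (F : fieldType) (m : nat)
    (mu : cubic_mul F m) (M : R -> R -> cubic F m) : Prop :=
  forall s tau t : R, 0 <= s -> s < tau -> tau < t ->
    M s t = mu (M s tau) (M tau t).

(* Main.v *)
Require Import Defs.
From mathcomp Require Import all_boot all_order all_algebra.
From mathcomp Require Import sesquilinear reals.

(** Expanding both factors of the product at [(s, t)] by their Kolmogorov-Chapman equations reduces
    the claim to the interchange law [(ab)(cd) = (ac)(bd)], which holds in any commutative
    semigroup. *)

Theorem theorem6 (R : realType) (F : fieldType) (m : nat) (mu : cubic_mul F m)
    (mu_assoc : associative mu) (mu_comm : commutative mu)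
    (M N : R -> R -> cubic F m)
    (M_FA : generates_FA mu M) (N_FA : generates_FA mu N) :
  generates_FA mu (fun s t : R => mu (M s t) (N s t)).
Proof.
move=> s tau t s_ge0 s_lt_tau tau_lt_t.
rewrite (M_FA _ _ _ s_ge0 s_lt_tau tau_lt_t) (N_FA _ _ _ s_ge0 s_lt_tau tau_lt_t).
set a := M s tau; set b := M tau t; set c := N s tau; set d := N tau t.
(* Only the inner factors are swapped: [(ab)(cd) = a((bc)d) = a((cb)d) = (ac)(bd)]. *)
by rewrite -(mu_assoc a b) (mu_assoc b c d) (mu_comm b c) -(mu_assoc c b d) (mu_assoc a c).
Qed.
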